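(* Let $d\ge 1$. There exist two positive constants $C_1(d)$ and $C_2(d)$, depending only on $d$, such that for every integer $N\ge 2$, every measurable set $B\subset\mathbb{T}^d$ of normalized measure $|B|\le \big(C_2(d)\,N(\log N)^{d-1}\big)^{-1}$ and every $f\in\mathcal{T}(N)$, $$\|f\|_\infty\le C_1(d)(\log N)^{d-1}\sup_{\mathbf{u}\in\mathbb{T}^d\setminus B}|f(\mathbf{u})|.$$
   Context: $\mathbb{T}^d$ is the $d$-dimensional torus $[0,2\pi)^d$ (functions are $2\pi$-periodic in each variable), and $|B|$ is the normalized Lebesgue measure, so $|\mathbb{T}^d|=1$. The hyperbolic cross is $$\Gamma(N):=\Big\{\mathbf{k}=(k_1,\dots,k_d)\in\mathbb{Z}^d:\ \prod_{j=1}^d\bar k_j\le N\Big\},\qquad \bar k_j:=\max(1,|k_j|),$$ and $$\mathcal{T}(N):=\Big\{f:\ f(\mathbf{x})=\sum_{\mathbf{k}\in\Gamma(N)}c_{\mathbf{k}}e^{i(\mathbf{k},\mathbf{x})},\ c_{\mathbf{k}}\in\mathbb{C}\Big\}.$$ $\|f\|_\infty$ is the supremum norm over $\mathbb{T}^d$. *)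

(* Defs.v *)
From HB Require Import structures.
From mathcomp Require Import all_boot all_order all_algebra.
From mathcomp Require Import all_classical all_reals all_analysis.
From mathcomp Require Import complex.

Set Implicit Arguments.
Unset Strict Implicit.
Unset Printing Implicit Defensive.

Import Order.TTheory GRing.Theory Num.Theory numFieldNormedType.Exports.

Local Open Scope classical_set_scope.
Local Open Scope ring_scope.

Definition torus (R : realType) (d : nat) : set (d.-tuple R) :=
  [set x | forall j : 'I_d, 0 <= tnth x j < 2 * pi].
Arguments torus : clear implicits.

Lemma two_pi_gt0 (R : realType) : 0 < 2 * pi :> R.
Proof. by rewrite mulr_gt0 // pi_gt0. Qed.

Section torus_measure.
Variable R : realType.

(* A copy of R carrying the display of lebesgue_measure and uniform_prob; it is
   convertible to R. *)
Local Notation mR := (measurableTypeR R).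

Definition pair_cons (d : nat) (p : mR * d.-tuple mR) : d.+1.-tuple mR :=
  [tuple of p.1 :: p.2].

Lemma measurable_pair_cons (d : nat) :
  measurable_fun [set: mR * d.-tuple mR] (@pair_cons d).
Proof. exact: measurable_cons. Qed.

HB.instance Definition _ (d : nat) :=
  isMeasurableFun.Build _ _ _ _ (@pair_cons d) (@measurable_pair_cons d).

(* The d-fold product of the normalized Lebesgue measure of [0, 2pi], as a Borel
   probability measure on R^d; it is concentrated on [0, 2pi)^d since endpoints
   are negligible. *)
Fixpoint torus_prob (d : nat) : probability (d.-tuple mR) R :=
  match d with
  | 0 => \d_([tuple] : 0.-tuple mR)
  | d'.+1 =>
      distribution (uniform_prob (two_pi_gt0 R) \x torus_prob d')%E
        (@pair_cons d')
  end.

End torus_measure.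

(* The Caratheodory extension of the Borel measure above, i.e. its completion:
   all Lebesgue measurable sets are covered, not only the Borel ones. *)
Definition torus_measure (R : realType) (d : nat) : set (d.-tuple R) -> \bar R :=
  (torus_prob R d)^*%mu.

Definition torus_measurable (R : realType) (d : nat) (B : set (d.-tuple R)) :=
  B `<=` torus R d /\ (@torus_measure R d).-caratheodory B.

Definition hyperbolic_cross (d N : nat) : set (d.-tuple int) :=
  [set k | (\prod_(j < d) maxn 1 `|tnth k j| <= N)%N].
Arguments hyperbolic_cross : clear implicits.

Definition expi (R : realType) (t : R) : R[i] := Complex (cos t) (sin t).

Definition dotp (R : realType) (d : nat) (k : d.-tuple int) (x : d.-tuple R) : R :=
  \sum_(j < d) (tnth k j)%:~R * tnth x j.

(* The sum below is finite because hyperbolic_cross d N is a finite set. *)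
Definition hyperbolic_poly (R : realType) (d N : nat) :
    set (d.-tuple R -> R[i]) :=
  [set f | exists c : d.-tuple int -> R[i],
     forall x, f x = \sum_(k \in hyperbolic_cross d N) c k * expi (dotp k x)].

(* Taken in the extended reals, so that no junk value can occur. *)
Definition sup_norm (R : realType) (d : nat) (A : set (d.-tuple R))
    (f : d.-tuple R -> R[i]) : \bar R :=
  ereal_sup [set (Normc.normc (f x))%:E | x in A].

(* Main.v *)
(* Every f in T(N) is reproduced by a kernel K on the torus with
   ||K||_1 <= C (log N)^(d-1) and ||K||_oo <= C N (log N)^(d-1).  Hence
   |f(x)| <= ||K||_1 sup_{T \ B} |f| + |B| ||K||_oo ||f||_oo, and the last term
   is at most ||f||_oo / 2 when |B| is small enough.

   With V_m a de la Vallee Poussin kernel (multiplier 1 on [-m, m], L^1 norm at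
   most 2, sup norm O(m)) and A_s = V_{2^s} - V_{2^(s-1)}, the kernel is V_{2^n}
   for d = 1 and K_{d+1,n}(x_0, x) = sum_{s <= n} A_s(x_0) K_{d,n-s+1}(x).  The
   multiplier of A_s vanishes at k_0 unless 2^s <= 2 max(1, |k_0|), and then
   K_{d,n-s+1} reproduces the remaining frequencies.  Starting at d = 1 with a
   single kernel, and not with a sum of blocks, is what gives the power d - 1 of
   the logarithm. *)
Require Import Defs.
From mathcomp Require Import all_boot all_order all_algebra.
From mathcomp Require Import all_classical all_reals all_analysis.
From mathcomp Require Import measurable_realfun complex ring lra zify.

Set Implicit Arguments.
Unset Strict Implicit.
Unset Printing Implicit Defensive.

Import Order.TTheory GRing.Theory Num.Theory numFieldNormedType.Exports.

Local Open Scope classical_set_scope.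
Local Open Scope ring_scope.

(** * Bounded measurable functions and their integrals against a probability measure *)

Section bounded_measurable.
Context {dT : measure_display} {T : measurableType dT} {R : realType}.
Implicit Types (f g : T -> R) (P : probability T R).

(** This class is stable under sums, products and absolute values, and all its members are
    integrable for every probability measure, so each later integrability condition follows from
    closure rules. *)
Definition bounded_mfun f :=
  measurable_fun setT f /\ exists M, forall x, `|f x| <= M.

Lemma bounded_mfun_cst (r : R) : bounded_mfun (fun=> r).
Proof. by split; [exact: measurable_cst | exists `|r|]. Qed.

Lemma bounded_mfunD f g :
  bounded_mfun f -> bounded_mfun g -> bounded_mfun (fun x => f x + g x).
Proof.
move=> [mf [A fA]] [mg [B gB]]; split; first exact: measurable_funD.
by exists (A + B) => x; rewrite (le_trans (ler_normD _ _)) ?lerD.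
Qed.

Lemma bounded_mfunM f g :
  bounded_mfun f -> bounded_mfun g -> bounded_mfun (fun x => f x * g x).
Proof.
move=> [mf [A fA]] [mg [B gB]]; split; first exact: measurable_funM.
by exists (A * B) => x; rewrite normrM ler_pM.
Qed.

Lemma bounded_mfunZ (r : R) f : bounded_mfun f -> bounded_mfun (fun x => r * f x).
Proof. by apply: bounded_mfunM; exact: bounded_mfun_cst. Qed.

Lemma bounded_mfunB f g :
  bounded_mfun f -> bounded_mfun g -> bounded_mfun (fun x => f x - g x).
Proof.
move=> bf /(bounded_mfunZ (-1)) bg.
by under eq_fun do rewrite -mulN1r; exact: bounded_mfunD.
Qed.

Lemma bounded_mfun_sum (I : Type) (s : seq I) (F : I -> T -> R) :
  (forall i, bounded_mfun (F i)) -> bounded_mfun (fun x => \sum_(i <- s) F i x).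
Proof.
move=> bF; elim: s => [|i s IH].
  by under eq_fun do rewrite big_nil; exact: bounded_mfun_cst.
by under eq_fun do rewrite big_cons; exact: bounded_mfunD.
Qed.

Lemma bounded_mfun_norm f : bounded_mfun f -> bounded_mfun (fun x => `|f x|).
Proof.
move=> [mf [A fA]]; split; first exact: measurableT_comp.
by exists A => x; rewrite normr_id.
Qed.

Lemma bounded_mfun_indic (A : set T) : measurable A -> bounded_mfun (\1_A : T -> R).
Proof.
move=> mA; split; first exact: measurable_indic.
by exists 1 => x; rewrite indicE ger0_norm; case: (x \in A).
Qed.

Lemma bounded_mfun_integrable P f :
  bounded_mfun f -> P.-integrable setT (EFin \o f).
Proof.
move=> [mf [M fM]]; apply: measurable_bounded_integrable => //.
  by rewrite (le_lt_trans (probability_le1 P measurableT)) ?ltry.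
exists `|M|; split; first by rewrite num_real.
by move=> x Mx y _; exact: le_trans (le_trans (fM y) (ler_norm M)) (ltW Mx).
Qed.

Lemma prob_RintegralD P f g : bounded_mfun f -> bounded_mfun g ->
  \int[P]_x (f x + g x) = \int[P]_x f x + \int[P]_x g x.
Proof. by move=> bf bg; rewrite RintegralD//; exact: bounded_mfun_integrable. Qed.

Lemma prob_RintegralZ P (r : R) f : bounded_mfun f ->
  \int[P]_x (r * f x) = r * \int[P]_x f x.
Proof. by move=> bf; rewrite RintegralZl//; exact: bounded_mfun_integrable. Qed.

Lemma prob_RintegralB P f g : bounded_mfun f -> bounded_mfun g ->
  \int[P]_x (f x - g x) = \int[P]_x f x - \int[P]_x g x.
Proof. by move=> bf bg; rewrite RintegralB//; exact: bounded_mfun_integrable. Qed.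

Lemma prob_Rintegral_cst P (r : R) : \int[P]_x r = r.
Proof. by rewrite Rintegral_cst// [X in fine X](probability_setT P) /= mulr1. Qed.

Lemma prob_Rintegral_sum P (I : Type) (s : seq I) (F : I -> T -> R) :
  (forall i, bounded_mfun (F i)) ->
  \int[P]_x (\sum_(i <- s) F i x) = \sum_(i <- s) \int[P]_x F i x.
Proof.
move=> bF; elim: s => [|i s IH].
  by rewrite big_nil -[RHS](prob_Rintegral_cst P); apply: eq_Rintegral => x _; rewrite big_nil.
rewrite big_cons -IH -prob_RintegralD//; last exact: bounded_mfun_sum.
by apply: eq_Rintegral => x _; rewrite big_cons.
Qed.

Lemma le_prob_Rintegral P f g : bounded_mfun f -> bounded_mfun g ->
  (forall x, f x <= g x) -> \int[P]_x f x <= \int[P]_x g x.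
Proof. by move=> bf bg fg; apply: le_Rintegral => //; exact: bounded_mfun_integrable. Qed.

Lemma le_norm_prob_Rintegral P f : bounded_mfun f ->
  `|\int[P]_x f x| <= \int[P]_x `|f x|.
Proof. by move=> bf; apply: le_normr_Rintegral => //; exact: bounded_mfun_integrable. Qed.

Lemma prob_Rintegral_indic P (A : set T) : measurable A ->
  \int[P]_x (\1_A x : R) = fine (P A).
Proof. by move=> mA; rewrite /Rintegral integral_indic// setIT. Qed.

End bounded_measurable.

Lemma bounded_mfun_comp {R : realType} d1 d2 (T1 : measurableType d1)
    (T2 : measurableType d2) (f : T2 -> R) (h : T1 -> T2) :
  measurable_fun setT h -> bounded_mfun f -> bounded_mfun (f \o h).
Proof.
move=> mh [mf [M fM]]; split; first exact: measurableT_comp.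
by exists M => x; exact: fM.
Qed.

(** * Integrals of products over the torus *)

Section torus_integral.
Context {R : realType}.
Local Notation mR := (measurableTypeR R).
Local Notation U := (uniform_prob (two_pi_gt0 R)).

Lemma measurable_thead_R n : measurable_fun setT (@thead n mR).
Proof. exact: measurable_tnth. Qed.

(** [torus_prob] in dimension [n.+1] is the image of a product measure under [pair_cons]: a change
    of variables followed by Fubini separates the first coordinate from the others. *)
Lemma torus_Rintegral_prod n (phi : mR -> R) (psi : n.-tuple mR -> R) :
  bounded_mfun phi -> bounded_mfun psi ->
  \int[torus_prob R n.+1]_u (phi (thead u) * psi [tuple of behead u]) =
  \int[U]_x phi x * \int[torus_prob R n]_u psi u.
Proof.
move=> bphi bpsi.
pose g (u : n.+1.-tuple mR) : R := phi (thead u) * psi [tuple of behead u].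
have bg : bounded_mfun g.
  apply: bounded_mfunM.
    by apply: (bounded_mfun_comp _ bphi); exact: measurable_thead_R.
  by apply: (bounded_mfun_comp _ bpsi); exact: measurable_behead.
have bgp : bounded_mfun (g \o @pair_cons R n).
  by apply: (bounded_mfun_comp _ bg); exact: measurable_pair_cons.
pose h (p : mR * n.-tuple mR) : R := phi p.1 * psi p.2.
have gh : g \o @pair_cons R n = h.
  apply/funext => -[x u]; rewrite /g /h /pair_cons /= theadE.
  by congr (_ * psi _); exact/val_inj.
rewrite /Rintegral /= integral_distribution; last 2 first.
- by apply/measurable_EFinP; case: bg.
- rewrite -/g.
  have := @bounded_mfun_integrable _ _ _ (U \x torus_prob R n)%E _ bgp.
  by [].
transitivity (fine (\int[U \x torus_prob R n]_z (h z)%:E)%E).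
  by rewrite -gh.
rewrite gh in bgp.
rewrite -integral12_prod_meas1; last first.
  exact: (@bounded_mfun_integrable _ _ _ (U \x torus_prob R n)%E _ bgp).
have -> : fubini_F (torus_prob R n) (EFin \o h) =
    fun x => (\int[torus_prob R n]_u psi u * phi x)%:E.
  apply/funext => x; rewrite /fubini_F /h/= mulrC EFinM.
  under eq_integral do rewrite EFinM.
  rewrite integralZl//; last exact: bounded_mfun_integrable.
  rewrite fineK//; apply: integrable_fin_num => //.
  exact: bounded_mfun_integrable.
rewrite [RHS]mulrC; exact: (@prob_RintegralZ _ _ _ U).
Qed.

End torus_integral.

(** * Cosine integrals and de la Vallee Poussin kernels on the circle *)

Section circle.
Context {R : realType}.
Local Notation mR := (measurableTypeR R).
Local Notation U := (uniform_prob (two_pi_gt0 R)).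

Lemma bounded_mfun_cos d (T : measurableType d) (h : T -> R) :
  measurable_fun setT h -> bounded_mfun (fun x => cos (h x)).
Proof.
move=> mh; split.
  apply: (@measurableT_comp _ _ _ _ _ _ (@cos R)) mh.
  by apply: continuous_measurable_fun; exact: continuous_cos.
by exists 1 => x; rewrite ler_norml cos_geN1 cos_le1.
Qed.

Lemma measurable_affine (t a : R) : measurable_fun setT (fun u : mR => t + a * u : R).
Proof. by apply: measurable_funD => //; exact: measurable_funM. Qed.

Lemma bounded_mfun_cos_affine (t a : R) :
  bounded_mfun (fun u : mR => cos (t + a * u) : R).
Proof. by apply: bounded_mfun_cos; exact: measurable_affine. Qed.

Lemma sin_period (x : R) (k : int) : sin (x + k%:~R * (2 * pi)) = sin x.
Proof.
have pern (n : nat) (y : R) : sin (y + n%:R * (2 * pi)) = sin y.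
  by rewrite !mulr_natl periodicn//; exact: sinD2pi.
case: k => n; first exact: pern.
by rewrite -(pern n.+1) NegzE mulrNz mulNr subrK.
Qed.

(** Orthogonality of characters in real form: the free phase [t] covers sines too, since they are
    cosines of phase -pi/2. *)
Lemma uniform_Rintegral_cos (k : int) (t : R) :
  \int[U]_u cos (t + k%:~R * u) = if k == 0 then cos t else 0.
Proof.
case: eqVneq => [->|k0].
  under eq_Rintegral do rewrite mul0r addr0.
  exact: (@prob_Rintegral_cst _ _ _ U).
have kR : k%:~R != 0 :> R by rewrite intr_eq0.
(* [integral_uniform] is for nonnegative functions, whence the 1. *)
suff : \int[U]_u (1 + cos (t + k%:~R * u)) = 1.
  rewrite (@prob_RintegralD _ _ _ U); last 2 first.
  - exact: bounded_mfun_cst.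
  - exact: bounded_mfun_cos_affine.
  by rewrite (@prob_Rintegral_cst _ _ _ U) => h; apply: (addrI 1); rewrite addr0.
rewrite /Rintegral integral_uniform; last 2 first.
- apply/measurable_EFinP; apply: measurable_funD => //.
  by have [] := bounded_mfun_cos_affine t k%:~R.
- by move=> x; rewrite lee_fin -lerBlDl sub0r cos_geN1.
(* An antiderivative of the integrand. Its sine term takes equal values at 0 and 2 pi, so only the
   linear term contributes. *)
pose F (u : R) : R := u + k%:~R^-1 * sin (t + k%:~R * u).
have dF (u : R) : is_derive u 1 F (1 + cos (t + k%:~R * u)).
  apply: is_derive_eq.
  rewrite /GRing.scale/=.
  by rewrite add0r mul1r mulr1 mulrCA mulVf// mulr1.
have cF : continuous F.
  by move=> u; apply: differentiable_continuous; apply/derivable1_diffP; case: (dF u).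
rewrite (@continuous_FTC2 _ _ F); first last.
- by move=> u _; rewrite derive1E; case: (dF u).
- split; first by move=> u _; case: (dF u).
  + exact/cvg_at_right_filter/cF.
  + exact/cvg_at_left_filter/cF.
- apply: continuous_subspaceT => u.
  apply: cvgD; first exact: cvg_cst.
  apply: continuous_comp; last exact: continuous_cos.
  by apply: cvgD; [exact: cvg_cst | apply: cvgMr; exact: cvg_id].
- exact: two_pi_gt0.
rewrite /F mulr0 addr0 sin_period -EFinB -EFinM /= add0r addrK subr0.
by rewrite mulVf// gt_eqF// two_pi_gt0.
Qed.

(** The product-to-sum formula leaves the frequencies [k - a] and [k + a] in [u], and only a zero
    frequency survives. Thus convolution with the cosine of frequency [a] is a Fourier multiplier
    with weight 1/2 at [a] and at [- a]. *)
Lemma uniform_Rintegral_coscos (a k : int) (x t : R) :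
  \int[U]_u (cos (a%:~R * (x - u)) * cos (t + k%:~R * u)) =
  2^-1 * ((k == a)%:R + (k == - a)%:R) * cos (t + k%:~R * x).
Proof.
under eq_Rintegral => u _.
  have -> : cos (a%:~R * (x - u)) * cos (t + k%:~R * u) =
      2^-1 * (cos (t + a%:~R * x + (k - a)%:~R * u) +
              cos (t - a%:~R * x + (k + a)%:~R * u)) :> R.
    set p := a%:~R * (x - u); set q := t + k%:~R * u.
    have -> : t + a%:~R * x + (k - a)%:~R * u = q + p by rewrite /p /q intrB; ring.
    have -> : t - a%:~R * x + (k + a)%:~R * u = q - p by rewrite /p /q intrD; ring.
    by rewrite cosD cosB; field.
  over.
rewrite (@prob_RintegralZ _ _ _ U); last first.
  by apply: bounded_mfunD; exact: bounded_mfun_cos_affine.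
rewrite (@prob_RintegralD _ _ _ U); [|exact: bounded_mfun_cos_affine..].
rewrite !uniform_Rintegral_cos subr_eq0 addr_eq0 -mulrA; congr (_ * _).
rewrite mulrDl; congr (_ + _).
  by case: eqVneq => [->|]; rewrite ?mul1r ?mul0r.
by case: eqVneq => [->|]; rewrite ?mul1r ?mul0r// mulrNz mulNr.
Qed.

Lemma bounded_mfun_cos_sub (a x : R) :
  bounded_mfun (fun u : mR => cos (a * (x - u)) : R).
Proof.
have := bounded_mfun_cos_affine (a * x) (- a).
by under eq_fun do rewrite mulNr -mulrBr.
Qed.

(** Parseval: the double sum is the squared modulus of an exponential sum with [n] distinct
    frequencies, and only its diagonal terms have nonzero mean. *)
Lemma uniform_Rintegral_dirichlet_sq (n : nat) (a : 'I_n -> int) (x : R) :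
  injective a ->
  \int[U]_u (\sum_i \sum_j cos ((a i - a j)%:~R * (x - u))) = n%:R.
Proof.
move=> ainj; rewrite (@prob_Rintegral_sum _ _ _ U); last first.
  by move=> i; apply: bounded_mfun_sum => j; exact: bounded_mfun_cos_sub.
transitivity (\sum_(i < n) (1 : R)); last first.
  by rewrite sumr_const card_ord.
apply: eq_bigr => i _; rewrite (@prob_Rintegral_sum _ _ _ U); last first.
  by move=> j; exact: bounded_mfun_cos_sub.
have E j : \int[U]_u cos ((a i - a j)%:~R * (x - u)) = (i == j)%:R :> R.
  (* At frequency and phase 0 the second cosine is 1, which leaves the mean of the first. *)
  have := uniform_Rintegral_coscos (a i - a j) 0 x 0.
  rewrite !mul0r !addr0 cos0 mulr1 (eq_sym 0) (eq_sym 0) oppr_eq0 subr_eq0 (inj_eq ainj).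
  have -> : 2^-1 * ((i == j)%:R + (i == j)%:R) = (i == j)%:R :> R by field.
  move=> <-; apply: eq_Rintegral => u _.
  by rewrite mul0r addr0 cos0 mulr1.
rewrite (bigD1 i)//= E eqxx big1 ?addr0// => j /negPf ji.
by rewrite E eq_sym ji.
Qed.

Lemma cos_double_sum (n p : nat) (a : 'I_n -> R) (b : 'I_p -> R) :
  \sum_i \sum_j cos (a i - b j) =
  (\sum_i cos (a i)) * (\sum_j cos (b j)) + (\sum_i sin (a i)) * (\sum_j sin (b j)).
Proof.
rewrite !big_distrl -big_split; apply: eq_bigr => i _ /=.
rewrite !big_distrr -big_split; apply: eq_bigr => j _ /=.
by rewrite cosB.
Qed.

(* The double sum is Re (D_a * conj D_b) for the exponential sums D_a, D_b, and
   2 |D_a D_b| <= |D_a|^2 + |D_b|^2. *)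
Lemma cos_double_sum_le (n p : nat) (a : 'I_n -> R) (b : 'I_p -> R) :
  `|\sum_i \sum_j cos (a i - b j)| <=
  2^-1 * (\sum_i \sum_j cos (a i - a j) + \sum_i \sum_j cos (b i - b j)).
Proof.
rewrite !cos_double_sum.
set A := \sum_i cos (a i); set B := \sum_i cos (b i).
set C := \sum_i sin (a i); set D := \sum_i sin (b i).
rewrite ler_norml; apply/andP; split.
  have := sqr_ge0 (A + B); have := sqr_ge0 (C + D); nra.
have := sqr_ge0 (A - B); have := sqr_ge0 (C - D); nra.
Qed.

(* A product of two Dirichlet kernels, over the frequencies 0..3m-1 and m..2m-1:
   if |k| <= m and m <= j < 2m then k + j lies in 0..3m-1, so the multiplier of
   this kernel is 1 on [-m, m]. *)
Definition vp_kernel (m : nat) (x : R) : R :=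
  m%:R^-1 * \sum_(i < 3 * m) \sum_(j < m) cos ((i%:Z - (m + j)%:Z)%:~R * x).

(** The Fourier coefficient of [vp_kernel m] at [k]: each cosine contributes 1/2 at each of its two
    opposite frequencies. *)
Definition vp_multiplier (m : nat) (k : int) : R :=
  m%:R^-1 * \sum_(i < 3 * m) \sum_(j < m)
    2^-1 * ((k == i%:Z - (m + j)%:Z)%:R + (k == - (i%:Z - (m + j)%:Z))%:R).

Lemma vp_kernel_bounded_mfun (m : nat) (x : R) :
  bounded_mfun (fun u : mR => vp_kernel m (x - u)).
Proof.
apply: bounded_mfunZ; apply: bounded_mfun_sum => i.
by apply: bounded_mfun_sum => j; exact: bounded_mfun_cos_sub.
Qed.

Lemma vp_kernel_sup (m : nat) (x : R) : `|vp_kernel m x| <= 3 * m%:R.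
Proof.
(* For [m = 0] the convention that 0 has inverse 0 makes the kernel vanish. *)
case: m => [|m].
  by rewrite /vp_kernel invr0 mul0r normr0 mulr0.
rewrite normrM ger0_norm ?invr_ge0// ler_pdivrMl// mulrCA.
apply: le_trans (ler_norm_sum _ _ _) _.
have -> : 3 * (m.+1%:R * m.+1%:R) = \sum_(i < 3 * m.+1) m.+1%:R :> R.
  by rewrite sumr_const card_ord mulrA -natrM mulr_natl.
apply: ler_sum => i _; apply: le_trans (ler_norm_sum _ _ _) _.
have -> : m.+1%:R = \sum_(j < m.+1) 1 :> R by rewrite sumr_const card_ord.
by apply: ler_sum => j _; rewrite cos_max.
Qed.

(** The kernel is bounded by half the sum of the two squared Dirichlet kernels, divided by [m]. By
    Parseval these have means 3m and m, and (3m + m) / (2m) = 2. *)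
Lemma vp_kernel_L1 (m : nat) (x : R) :
  \int[U]_u `|vp_kernel m (x - u)| <= 2.
Proof.
pose a (i : 'I_(3 * m)) : int := i%:Z.
pose b (j : 'I_m) : int := (m + j)%:Z.
pose A u : R := \sum_i \sum_j cos ((a i - a j)%:~R * (x - u)).
pose B u : R := \sum_i \sum_j cos ((b i - b j)%:~R * (x - u)).
have bA : bounded_mfun (A : mR -> R).
  by apply: bounded_mfun_sum => i; apply: bounded_mfun_sum => j; exact: bounded_mfun_cos_sub.
have bB : bounded_mfun (B : mR -> R).
  by apply: bounded_mfun_sum => i; apply: bounded_mfun_sum => j; exact: bounded_mfun_cos_sub.
have le1 u : `|vp_kernel m (x - u)| <= m%:R^-1 * (2^-1 * (A u + B u)).
  rewrite normrM ger0_norm ?invr_ge0//; apply: ler_wpM2l; first by rewrite invr_ge0.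
  have := cos_double_sum_le (fun i => (a i)%:~R * (x - u)) (fun j => (b j)%:~R * (x - u)).
  rewrite /A /B.
  under eq_bigr do under eq_bigr do rewrite -mulrBl -intrB.
  under [X in _ <= _ * (X + _)]eq_bigr do under eq_bigr do rewrite -mulrBl -intrB.
  by under [X in _ <= _ * (_ + X)]eq_bigr do under eq_bigr do rewrite -mulrBl -intrB.
apply: le_trans (@le_prob_Rintegral _ _ _ U _ _ _ _ le1) _.
- by apply: bounded_mfun_norm; exact: vp_kernel_bounded_mfun.
- by do 2 apply: bounded_mfunZ; exact: bounded_mfunD.
rewrite (@prob_RintegralZ _ _ _ U); last by apply: bounded_mfunZ; exact: bounded_mfunD.
rewrite (@prob_RintegralZ _ _ _ U); last exact: bounded_mfunD.
rewrite (@prob_RintegralD _ _ _ U)// !uniform_Rintegral_dirichlet_sq; first last.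
- by move=> i j [] /ord_inj.
- by move=> i j [] /addnI /ord_inj.
have [->|m0] := eqVneq m 0%N; first by rewrite invr0 mul0r.
have m1 : m%:R != 0 :> R by rewrite pnatr_eq0.
by rewrite natrM le_eqVlt; apply/orP; left; apply/eqP; field.
Qed.

Lemma vp_kernel_mult (m : nat) (x t : R) (k : int) :
  \int[U]_u (vp_kernel m (x - u) * cos (t + k%:~R * u)) =
  vp_multiplier m k * cos (t + k%:~R * x).
Proof.
have b (i j : nat) : bounded_mfun (fun u : mR =>
    cos ((i%:Z - (m + j)%:Z)%:~R * (x - u)) * cos (t + k%:~R * u)).
  apply: bounded_mfunM; [exact: bounded_mfun_cos_sub|exact: bounded_mfun_cos_affine].
under eq_Rintegral => u _.
  rewrite /vp_kernel -mulrA big_distrl /=.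
  under eq_bigr do rewrite big_distrl /=.
  over.
rewrite (@prob_RintegralZ _ _ _ U); last first.
  by apply: bounded_mfun_sum => i; exact: bounded_mfun_sum.
rewrite (@prob_Rintegral_sum _ _ _ U); last by move=> i; exact: bounded_mfun_sum.
rewrite /vp_multiplier -mulrA big_distrl /=; congr (_ * _).
apply: eq_bigr => i _; rewrite (@prob_Rintegral_sum _ _ _ U)// big_distrl /=.
by apply: eq_bigr => j _; rewrite uniform_Rintegral_coscos.
Qed.

(** For each [j], exactly one [i] matches [k] and exactly one matches [- k], each with weight 1/2;
    averaging over the [m] values of [j] gives 1. *)
Lemma vp_multiplier1 (m : nat) (k : int) :
  (0 < m)%N -> (`|k| <= m)%N -> vp_multiplier m k = 1.
Proof.
move=> m0 km; rewrite /vp_multiplier exchange_big /=.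
have one (l : int) (j : 'I_m) : (`|l| <= m)%N ->
    \sum_(i < 3 * m) (l == i%:Z - (m + j)%:Z)%:R = 1 :> R.
  move=> lm; have jm := ltn_ord j.
  have i0m : (absz (l + (m + j)%:Z)%R < 3 * m)%N by lia.
  rewrite (bigD1 (Ordinal i0m))//= big1 ?addr0.
    by rewrite (_ : _ == _)//; apply/eqP; lia.
  move=> i /eqP ii; rewrite (_ : (_ == _) = false)//; apply/negP => /eqP li; apply: ii.
  by apply: ord_inj => /=; lia.
transitivity (m%:R^-1 * \sum_(j < m) (1 : R)); last first.
  by rewrite sumr_const card_ord mulVf// pnatr_eq0 -lt0n.
congr (_ * _); apply: eq_bigr => j _.
rewrite -big_distrr/= big_split/= one//.
under eq_bigr do rewrite -eqr_oppLR.
by rewrite one ?abszN//; field.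
Qed.

End circle.

(** * Dyadic blocks and the reproducing kernel of the hyperbolic cross *)

Section hyperbolic_kernel.
Context {R : realType}.
Local Notation mR := (measurableTypeR R).
Local Notation U := (uniform_prob (two_pi_gt0 R)).

(** The block of index 0 is the whole kernel V_1, so that the blocks up to [n] telescope to
    V_{2^n}. *)
Definition dyadic_block (s : nat) (x : R) : R :=
  vp_kernel (2 ^ s) x - if s is s'.+1 then vp_kernel (2 ^ s') x else 0.

Definition block_multiplier (s : nat) (k : int) : R :=
  vp_multiplier (2 ^ s) k - if s is s'.+1 then vp_multiplier (2 ^ s') k else 0.

Lemma dyadic_block_bounded_mfun (s : nat) (x : R) :
  bounded_mfun (fun u : mR => dyadic_block s (x - u)).
Proof.
apply: bounded_mfunB; first exact: vp_kernel_bounded_mfun.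
by case: s => [|s]; [exact: bounded_mfun_cst|exact: vp_kernel_bounded_mfun].
Qed.

Lemma dyadic_block_sup (s : nat) (x : R) : `|dyadic_block s x| <= 6 * 2 ^+ s.
Proof.
apply: le_trans (ler_normB _ _) _.
rewrite (_ : 6 * _ = 3 * 2 ^+ s + 3 * 2 ^+ s); last by ring.
apply: lerD; first by rewrite -natrX vp_kernel_sup.
case: s => [|s]; first by rewrite normr0 expr0; lra.
apply: le_trans (vp_kernel_sup _ _) _; rewrite natrX ler_wpM2l// exprS.
by have := exprn_ge0 s (ler0n R 2); lra.
Qed.

Lemma dyadic_block_L1 (s : nat) (x : R) :
  \int[U]_u `|dyadic_block s (x - u)| <= 4.
Proof.
case: s => [|s].
  rewrite /dyadic_block; under eq_Rintegral do rewrite subr0.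
  by apply: le_trans (vp_kernel_L1 _ _) _; rewrite ler_nat.
have le1 u : `|dyadic_block s.+1 (x - u)| <=
    `|vp_kernel (2 ^ s.+1) (x - u)| + `|vp_kernel (2 ^ s) (x - u)|.
  exact: ler_normB.
apply: le_trans (@le_prob_Rintegral _ _ _ U _ _ _ _ le1) _.
- by apply: bounded_mfun_norm; exact: dyadic_block_bounded_mfun.
- by apply: bounded_mfunD; apply: bounded_mfun_norm; exact: vp_kernel_bounded_mfun.
rewrite (@prob_RintegralD _ _ _ U); [|by apply: bounded_mfun_norm; exact: vp_kernel_bounded_mfun..].
by have := vp_kernel_L1 (2 ^ s.+1) x; have := vp_kernel_L1 (2 ^ s) x; lra.
Qed.

Lemma dyadic_block_mult (s : nat) (x t : R) (k : int) :
  \int[U]_u (dyadic_block s (x - u) * cos (t + k%:~R * u)) =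
  block_multiplier s k * cos (t + k%:~R * x).
Proof.
have b m : bounded_mfun (fun u : mR => vp_kernel m (x - u) * cos (t + k%:~R * u)).
  by apply: bounded_mfunM; [exact: vp_kernel_bounded_mfun|exact: bounded_mfun_cos_affine].
rewrite /dyadic_block /block_multiplier; case: s => [|s].
  by under eq_Rintegral do rewrite subr0; rewrite subr0 vp_kernel_mult.
under eq_Rintegral do rewrite mulrBl.
by rewrite (@prob_RintegralB _ _ _ U)// !vp_kernel_mult mulrBl.
Qed.

(** If max(1, |k|) < 2^(s-1), both kernels of the block have multiplier 1 at [k], and the difference
    cancels. *)
Lemma block_multiplier_neq0 (s : nat) (k : int) :
  block_multiplier s k != 0 -> (2 ^ s <= 2 * maxn 1 `|k|)%N.
Proof.
case: s => [|s] b0; first by rewrite expn0; lia.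
rewrite leqNgt; apply: contraNN b0; rewrite expnS ltn_pmul2l// => ks.
rewrite /block_multiplier !vp_multiplier1 ?subrr ?expn_gt0//; first by lia.
by rewrite expnS; lia.
Qed.

Lemma sum_block_multiplier (n : nat) (k : int) :
  \sum_(s < n.+1) block_multiplier s k = vp_multiplier (2 ^ n) k :> R.
Proof.
elim: n => [|n IH]; first by rewrite big_ord1 /block_multiplier subr0.
by rewrite big_ord_recr /= IH /block_multiplier addrC subrK.
Qed.

Lemma dotpS (d : nat) (k : d.+1.-tuple int) (u : d.+1.-tuple R) :
  dotp k u = (thead k)%:~R * thead u +
             dotp [tuple of behead k] [tuple of behead u].
Proof.
rewrite /dotp big_ord_recl; congr (_ + _).
apply: eq_bigr => j _; rewrite !tnth_behead.
by have -> : lift ord0 j = inord j.+1 by apply/val_inj; rewrite /= inordK ?ltnS.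
Qed.

Lemma bounded_mfun_cos_dotp (d : nat) (t : R) (k : d.-tuple int) :
  bounded_mfun (fun u : d.-tuple mR => cos (t + dotp k u) : R).
Proof.
apply: bounded_mfun_cos; apply: measurable_funD => //.
apply: measurable_sum => j; apply: measurable_funM => //.
exact: measurable_tnth.
Qed.

(** The addition formula splits the cosine into products of a function of the first coordinate and a
    function of the others, which integrate separately. The alternative [a = 0] asks nothing of
    [psi]: a block whose multiplier vanishes may be paired with a kernel that does not reproduce the
    remaining frequencies. *)
Lemma torus_Rintegral_prod_cos (d : nat) (phi : mR -> R) (psi : d.-tuple mR -> R)
    (k : d.+1.-tuple int) (x : d.+1.-tuple R) (a : R) :
  bounded_mfun phi -> bounded_mfun psi ->
  (forall t, \int[U]_u (phi u * cos (t + (thead k)%:~R * u)) =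
             a * cos (t + (thead k)%:~R * thead x)) ->
  a = 0 \/
  (forall t, \int[torus_prob R d]_u (psi u * cos (t + dotp [tuple of behead k] u)) =
             cos (t + dotp [tuple of behead k] [tuple of behead x])) ->
  forall t,
  \int[torus_prob R d.+1]_u
    (phi (thead u) * psi [tuple of behead u] * cos (t + dotp k u)) =
  a * cos (t + dotp k x).
Proof.
move=> bphi bpsi iphi apsi t.
set k0 := (thead k)%:~R : R; set k' := [tuple of behead k].
have shift y : sin y = cos (- (pi / 2) + y) :> R by rewrite addrC cosBpihalf.
pose phic (u : mR) : R := phi u * cos (t + k0 * u).
pose phis (u : mR) : R := phi u * sin (t + k0 * u).
pose psic (u : d.-tuple mR) : R := psi u * cos (0 + dotp k' u).
pose psis (u : d.-tuple mR) : R := psi u * cos (- (pi / 2) + dotp k' u).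
have bphic : bounded_mfun phic by apply: bounded_mfunM => //; exact: bounded_mfun_cos_affine.
have bphis : bounded_mfun phis.
  apply: bounded_mfunM => //; under eq_fun do rewrite shift addrA.
  exact: bounded_mfun_cos_affine.
have bpsic : bounded_mfun psic by apply: bounded_mfunM => //; exact: bounded_mfun_cos_dotp.
have bpsis : bounded_mfun psis by apply: bounded_mfunM => //; exact: bounded_mfun_cos_dotp.
have bprod (f : mR -> R) (g : d.-tuple mR -> R) : bounded_mfun f -> bounded_mfun g ->
    bounded_mfun (fun u : d.+1.-tuple mR => f (thead u) * g [tuple of behead u]).
  move=> bf bg; apply: bounded_mfunM.
    by apply: (bounded_mfun_comp _ bf); exact: measurable_thead_R.
  by apply: (bounded_mfun_comp _ bg); exact: measurable_behead.
under eq_Rintegral => u _.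
  have -> : phi (thead u) * psi [tuple of behead u] * cos (t + dotp k u) =
      phic (thead u) * psic [tuple of behead u] -
      phis (thead u) * psis [tuple of behead u].
    rewrite /phic /phis /psic /psis -shift add0r dotpS addrA (cosD (t + _)) -/k0 -/k'.
    ring.
  over.
rewrite prob_RintegralB; [|exact: bprod..].
rewrite !torus_Rintegral_prod//.
have -> : \int[U]_u phic u = a * cos (t + k0 * thead x) by rewrite iphi.
have -> : \int[U]_u phis u = a * sin (t + k0 * thead x).
  rewrite shift addrA -iphi; apply: eq_Rintegral => u _.
  by rewrite /phis shift addrA.
case: apsi => [->|ipsi]; first by rewrite !mul0r subrr.
rewrite /psic /psis !ipsi -shift add0r dotpS addrA (cosD (t + _)) -/k0 -/k'; ring.
Qed.

(** [K] stands for a kernel centred at the fixed point [x]; [L] and [S] bound its L^1 and sup norms.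
    As [K] is real, reproducing cosines of every phase [t] amounts to reproducing exponentials. *)
Definition reproducing_at (d : nat) (x : d.-tuple R) (N : nat) (L S : R)
    (K : d.-tuple mR -> R) :=
  [/\ bounded_mfun K, forall u, `|K u| <= S, \int[torus_prob R d]_u `|K u| <= L &
   forall k, hyperbolic_cross d N k -> forall t,
     \int[torus_prob R d]_u (K u * cos (t + dotp k u)) = cos (t + dotp k x)].

Lemma hyperbolic_crossS (d N : nat) (k : d.+1.-tuple int) :
  hyperbolic_cross d.+1 N k =
  ((maxn 1 `|thead k| * \prod_(j < d) maxn 1 `|tnth [tuple of behead k] j| <= N)%N : Prop).
Proof.
rewrite /hyperbolic_cross /= big_ord_recl; congr (is_true (_ * _ <= _)%N).
apply: eq_bigr => j _; rewrite tnth_behead.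
by have -> : lift ord0 j = inord j.+1 by apply/val_inj; rewrite /= inordK ?ltnS.
Qed.

(** The L^1 bound 2 is relaxed to 3 so that one constant serves both norms when the induction on the
    dimension starts. *)
Lemma exists_reproducing1 (n : nat) (x : 1.-tuple R) :
  exists K, reproducing_at x (2 ^ n) 3 (3 * 2 ^+ n) K.
Proof.
pose K (u : 1.-tuple mR) : R := vp_kernel (2 ^ n) (thead x - thead u).
have b1 := @bounded_mfun_cst _ (0.-tuple mR) R 1.
have bv := vp_kernel_bounded_mfun (2 ^ n) (thead x).
exists K; split.
- by apply: (bounded_mfun_comp _ bv); exact: measurable_thead_R.
- by move=> u; rewrite -natrX; exact: vp_kernel_sup.
- have := torus_Rintegral_prod (bounded_mfun_norm bv) b1.
  rewrite prob_Rintegral_cst mulr1; under eq_Rintegral do rewrite mulr1.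
  by move=> ->; apply: le_trans (vp_kernel_L1 _ _) _; rewrite ler_nat.
- move=> k; rewrite hyperbolic_crossS big_ord0 muln1 => kn t.
  under eq_Rintegral do rewrite -[K _]mulr1.
  rewrite (torus_Rintegral_prod_cos bv b1 (x := x) (a := 1)) ?mul1r//.
  + move=> t'; rewrite vp_kernel_mult vp_multiplier1 ?expn_gt0//.
    by move: kn; rewrite geq_max => /andP[].
  + right=> t'; rewrite /dotp big_ord0; under eq_Rintegral do rewrite big_ord0 mul1r.
    exact: prob_Rintegral_cst.
Qed.

(** The dimension is [d.+1], so the exponent [d] is the power of the logarithm in the theorem;
    [n.+1] plays the role of log N. *)
Lemma exists_reproducing (d : nat) : exists2 C : R, 0 < C &
  forall (n : nat) (x : d.+1.-tuple R), exists K,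
    reproducing_at x (2 ^ n) (C * n.+1%:R ^+ d) (C * 2 ^+ n * n.+1%:R ^+ d) K.
Proof.
elim: d => [|d [C C0 IH]].
  exists 3 => // n x; rewrite expr0 !mulr1; exact: exists_reproducing1.
(* The sup norm of term [s] is at most (6 2^s)(C 2^(n-s+1) (n-s+2)^d), and n-s+2 <= 2(n+1) yields
   the factor 2^d. The L^1 norms only need 4 in place of 12. Summing the n+1 terms raises the
   exponent by one. *)
exists (12 * 2 ^+ d * C); first by rewrite !mulr_gt0// exprn_gt0.
move=> n x; set x' := [tuple of behead x] : d.+1.-tuple R.
have /choice[K HK] := fun m => IH m x'.
pose A s (u : mR) : R := dyadic_block s (thead x - u).
pose F (s : 'I_n.+1) (u : d.+2.-tuple mR) : R :=
  A s (thead u) * K (n - s).+1 [tuple of behead u].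
have bA s : bounded_mfun (A s) by exact: dyadic_block_bounded_mfun.
have bK m : bounded_mfun (K m) by have [] := HK m.
have bF s : bounded_mfun (F s).
  apply: bounded_mfunM.
    by apply: (bounded_mfun_comp _ (bA s)); exact: measurable_thead_R.
  by apply: (bounded_mfun_comp _ (bK _)); exact: measurable_behead.
have powle (s : nat) : ((n - s).+2%:R : R) ^+ d <= 2 ^+ d * n.+1%:R ^+ d.
  by rewrite -exprMn lerXn2r ?nnegrE// -natrM ler_nat; lia.
have e2 := exprn_gt0 n (ltr0n R 2).
exists (fun u => \sum_(s < n.+1) F s u); split.
- exact: bounded_mfun_sum.
- move=> u; apply: le_trans (ler_norm_sum _ _ _) _.
  apply: (@le_trans _ _ (\sum_(s < n.+1) (12 * 2 ^+ d * C * 2 ^+ n * n.+1%:R ^+ d))); last first.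
    by rewrite sumr_const card_ord exprSr -[leLHS]mulr_natr mulrA.
  apply: ler_sum => s _; rewrite normrM.
  have [_ Ks _ _] := HK (n - s).+1.
  apply: (@le_trans _ _ ((6 * 2 ^+ s) * (C * 2 ^+ (n - s).+1 * (n - s).+2%:R ^+ d))).
    by apply: ler_pM => //; exact: dyadic_block_sup.
  have -> : 2 ^+ n = 2 ^+ s * 2 ^+ (n - s) :> R.
    by rewrite -exprD subnKC// -ltnS.
  rewrite exprS.
  set p := 2 ^+ s; set q := 2 ^+ (n - s).
  have -> : 12 * 2 ^+ d * C * (p * q) * n.+1%:R ^+ d =
      (12 * C * p * q) * (2 ^+ d * n.+1%:R ^+ d) by ring.
  have -> : 6 * p * (C * (2 * q) * (n - s).+2%:R ^+ d) =
      (12 * C * p * q) * (n - s).+2%:R ^+ d by ring.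
  by rewrite ler_wpM2l// !mulr_ge0// ?exprn_ge0// ltW.
- apply: (@le_trans _ _ (\int[torus_prob R d.+2]_u \sum_(s < n.+1) `|F s u|)).
    apply: le_prob_Rintegral.
    + by apply: bounded_mfun_norm; exact: bounded_mfun_sum.
    + by apply: bounded_mfun_sum => s; exact: bounded_mfun_norm.
    + by move=> u; exact: ler_norm_sum.
  rewrite prob_Rintegral_sum; last by move=> s; exact: bounded_mfun_norm.
  apply: (@le_trans _ _ (\sum_(s < n.+1) (12 * 2 ^+ d * C * n.+1%:R ^+ d))); last first.
    by rewrite sumr_const card_ord exprSr -[leLHS]mulr_natr mulrA.
  apply: ler_sum => s _.
  have [_ _ Ks _] := HK (n - s).+1.
  under eq_Rintegral do rewrite normrM.
  rewrite (torus_Rintegral_prod (bounded_mfun_norm (bA s)) (bounded_mfun_norm (bK _))).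
  apply: (@le_trans _ _ (4 * (C * (n - s).+2%:R ^+ d))).
    by apply: ler_pM => //; [exact: Rintegral_ge0|exact: Rintegral_ge0|exact: dyadic_block_L1].
  have := ler_wpM2l (ltW C0) (powle s).
  have : 0 <= C * (2 ^+ d * n.+1%:R ^+ d) by rewrite !mulr_ge0// ?exprn_ge0// ltW.
  lra.
- move=> k; rewrite hyperbolic_crossS => kn t.
  under eq_Rintegral do rewrite big_distrl.
  rewrite prob_Rintegral_sum; last first.
    by move=> s; apply: bounded_mfunM => //; exact: bounded_mfun_cos_dotp.
  (* The factor 1 is written as the multiplier of V_{2^n} at the first frequency, then split into
     block multipliers and matched term by term. *)
  rewrite -[RHS]mul1r -(@vp_multiplier1 _ (2 ^ n) (thead k)) ?expn_gt0//; last first.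
    apply: leq_trans kn; apply: leq_trans (leq_maxr 1 _) _.
    by rewrite leq_pmulr// prodn_gt0// => j; rewrite leq_maxl.
  rewrite -sum_block_multiplier big_distrl/=; apply: eq_bigr => s _.
  apply: (torus_Rintegral_prod_cos (bA s) (bK _)) => [t'|].
    exact: dyadic_block_mult.
  have [->|/block_multiplier_neq0 ks] := eqVneq (block_multiplier s (thead k)) (0 : R).
    by left.
  right; have [_ _ _ repr] := HK (n - s).+1; apply: repr; rewrite /hyperbolic_cross /=.
  have sn : (s <= n)%N by rewrite -ltnS.
  (* With P the product over the remaining frequencies, 2^s P <= 2 max(1, |k_0|) P <= 2^(n+1). The
     factor 2 is why the level is n-s+1 and not n-s. *)
  rewrite -(@leq_pmul2l (2 ^ s)) ?expn_gt0// -expnD addnS subnKC// expnS.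
  by apply: leq_trans (leq_mul ks (leqnn _)) _; rewrite -mulnA leq_mul2l kn orbT.
Qed.

End hyperbolic_kernel.

(** * The pointwise estimate from a reproducing kernel *)

Section remez_bound.
Context {R : realType}.
Local Notation mR := (measurableTypeR R).

(** All factors are at least 1, so each |k_j| is at most [N]; shifting coordinates by [N] encodes
    the cross in a finite type. *)
Lemma finite_hyperbolic_cross (d N : nat) : finite_set (hyperbolic_cross d N).
Proof.
pose g (i : 'I_(2 * N).+1) : int := i%:Z - N%:Z.
pose h (t : d.-tuple 'I_(2 * N).+1) : d.-tuple int := [tuple g (tnth t j) | j < d].
apply: (@sub_finite_set _ _ (h @` [set: d.-tuple 'I_(2 * N).+1])); last first.
  exact/finite_image/finite_finset.
move=> k /= kN.
have kjN j : (`|tnth k j| <= N)%N.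
  apply: leq_trans kN; rewrite (bigD1 j)//=; apply: leq_trans (leq_maxr 1 _) _.
  by rewrite leq_pmulr// prodn_gt0// => i; rewrite leq_maxl.
have kb j : (absz (tnth k j + N%:Z)%R < (2 * N).+1)%N by have := kjN j; lia.
exists [tuple Ordinal (kb j) | j < d] => //.
apply: eq_from_tnth => j; rewrite !tnth_mktuple /g /=; have := kjN j; lia.
Qed.

Lemma indic_torusS (d : nat) (u : d.+1.-tuple R) :
  \1_(torus R d.+1) u = \1_(`[0, 2 * pi[%classic) (thead u) *
                        \1_(torus R d) [tuple of behead u] :> R.
Proof.
rewrite !indicE -natrM mulnb; congr (nat_of_bool _)%:R.
apply/idP/andP => [/set_mem uT|[/set_mem u0 /set_mem uT]].
  split; apply/mem_set; first by rewrite /= in_itv/=; exact: uT ord0.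
  by move=> j; rewrite tnth_behead; exact: uT.
apply/mem_set => j; rewrite /= in_itv/= in u0.
have [->//|j0] := eqVneq j ord0.
have j0' : (0 < j)%N by rewrite lt0n; apply: contra_neq j0 => /= j0; exact/val_inj.
have jd : (j.-1 < d)%N by rewrite prednK// -ltnS.
have := uT (Ordinal jd); rewrite tnth_behead /= prednK//.
by rewrite inord_val.
Qed.

Lemma measurable_torus (d : nat) : measurable (torus R d : set (d.-tuple mR)).
Proof.
have -> : torus R d = \bigcap_(j in [set: 'I_d]) ((@tnth d mR)^~ j @^-1` `[0, 2 * pi[%classic).
  apply/seteqP; split => u uT j.
    by move=> _ /=; rewrite in_itv/=; exact: uT.
  by have := uT j I; rewrite /= in_itv/=.
apply: fin_bigcap_measurable => [|j _]; first exact: finite_finset.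
by rewrite -[X in measurable X]setTI; apply: measurable_tnth.
Qed.

(** The half-open interval has the same length as the closed one carrying the uniform law. This
    makes values of [f] outside the torus irrelevant under the integral. *)
Lemma torus_prob_torus (d : nat) : \int[torus_prob R d]_u (\1_(torus R d) u : R) = 1.
Proof.
elim: d => [|d IH].
  rewrite -[RHS](prob_Rintegral_cst (torus_prob R 0)); apply: eq_Rintegral => u _.
  by rewrite indicE mem_set// => -[].
under eq_Rintegral do rewrite (@indic_torusS d).
have mI : measurable (`[0, 2 * pi[%classic : set mR) by [].
rewrite (torus_Rintegral_prod (bounded_mfun_indic mI)
  (bounded_mfun_indic (@measurable_torus d))) IH mulr1 /Rintegral integral_uniform; last 2 first.
- exact/measurable_EFinP/measurable_indic.
- by move=> y; rewrite lee_fin indicE.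
have sub : `[0, 2 * pi[%classic `<=` (`[0, 2 * pi]%classic : set mR).
  by move=> y /=; rewrite !in_itv/= => /andP[-> /ltW].
rewrite integral_indic// (setIidl sub).
rewrite [X in (_ * X)%E]lebesgue_measure_itv/= lte_fin two_pi_gt0 -EFinB -EFinM /= subr0.
by rewrite mulVf// gt_eqF// two_pi_gt0.
Qed.

(** The outer measure is an infimum over countable measurable covers; the strict inequality provides
    a cover of total mass below [e], whose union is a Borel set to integrate over. *)
Lemma torus_measure_hull (d : nat) (B : set (d.-tuple R)) (e : R) :
  (torus_measure B < e%:E)%E ->
  exists B' : set (d.-tuple mR),
    [/\ measurable B', B `<=` B' & fine (torus_prob R d B') <= e].
Proof.
move=> /ereal_inf_lt[_ [F [mF BF] <-] Fe].
have mU : measurable (\bigcup_k F k) by exact: bigcup_measurable.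
exists (\bigcup_k F k); split => //.
have le1 := measure_sigma_subadditive (torus_prob R d) mF mU (@subset_refl _ _).
by rewrite -lee_fin fineK ?fin_num_measure//; apply: le_trans le1 (ltW Fe).
Qed.

Lemma Re_le_normc (z : R[i]) : `|complex.Re z| <= Normc.normc z.
Proof.
by case: z => a b; rewrite /= -sqrtr_sqr ler_wsqrtr// lerDl sqr_ge0.
Qed.

Lemma normc_ge0 (z : R[i]) : 0 <= Normc.normc z.
Proof. by case: z => a b; exact: sqrtr_ge0. Qed.

Lemma hyperbolic_polyE (d N : nat) (f : d.-tuple R -> R[i]) :
  hyperbolic_poly N f ->
  exists (s : seq (d.-tuple int)) (c : d.-tuple int -> R[i]),
    (forall k, k \in s -> hyperbolic_cross d N k) /\
    forall x, f x = \sum_(k <- s) c k * expi (dotp k x).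
Proof.
move=> [c fE]; exists (finmap.enum_fset (fset_set (hyperbolic_cross d N))), c; split.
  by move=> k; rewrite in_fset_set; [exact: set_mem|exact: finite_hyperbolic_cross].
by move=> x; rewrite fE fsbig_finite//; exact: finite_hyperbolic_cross.
Qed.

Lemma hyperbolic_poly_bounded (d N : nat) (f : d.-tuple R -> R[i]) :
  hyperbolic_poly N f -> exists G, forall x, Normc.normc (f x) <= G.
Proof.
move=> /hyperbolic_polyE[s [c [_ fE]]].
exists (\sum_(k <- s) Normc.normc (c k)) => x; rewrite fE.
elim: s {fE} => [|k s IH]; first by rewrite !big_nil Normc.normc0.
rewrite !big_cons; apply: le_trans (le_normcD _ _) _; apply: lerD => //.
by rewrite Normc.normcM /= cos2Dsin2 sqrtr1 mulr1.
Qed.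

(** The real part of (p + iq) e^{iy} is p cos y - q sin y; writing the sine as a cosine of phase
    -pi/2 gives the form that [reproducing_at] handles. *)
Lemma Re_hyperbolic_polyE (d N : nat) (f : d.-tuple R -> R[i]) (w : R[i]) :
  hyperbolic_poly N f ->
  exists (s : seq (d.-tuple int)) (a b : d.-tuple int -> R),
    (forall k, k \in s -> hyperbolic_cross d N k) /\
    forall x, complex.Re (w * f x) =
      \sum_(k <- s) (a k * cos (0 + dotp k x) + b k * cos (- (pi / 2) + dotp k x)).
Proof.
move=> /hyperbolic_polyE[s [c [sN fE]]].
have ReD (y z : R[i]) : complex.Re (y + z) = complex.Re y + complex.Re z.
  by case: y; case: z.
exists s, (fun k => complex.Re (w * c k)), (fun k => - complex.Im (w * c k)).
split=> // x; rewrite {}fE.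
elim: s {sN} => [|k s IH]; first by rewrite !big_nil mulr0.
rewrite !big_cons mulrDr ReD IH; congr (_ + _).
rewrite mulrA; case: (w * c k) => p q /=.
by rewrite add0r [- _ + _]addrC cosBpihalf mulNr.
Qed.

Lemma reproducing_Re (d N : nat) (x : d.-tuple R) L S K (f : d.-tuple R -> R[i]) (w : R[i]) :
  reproducing_at x N L S K -> hyperbolic_poly N f ->
  bounded_mfun (fun u : d.-tuple mR => complex.Re (w * f u)) /\
  \int[torus_prob R d]_u (K u * complex.Re (w * f u)) = complex.Re (w * f x).
Proof.
move=> [bK _ _ repr] /(Re_hyperbolic_polyE w)[s [a [b [sN fE]]]].
have bt k : bounded_mfun (fun u : d.-tuple mR =>
    a k * cos (0 + dotp k u) + b k * cos (- (pi / 2) + dotp k u)).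
  by apply: bounded_mfunD; apply: bounded_mfunZ; exact: bounded_mfun_cos_dotp.
split; first by under eq_fun do rewrite fE; exact: bounded_mfun_sum.
under eq_Rintegral do rewrite fE big_distrr/=.
rewrite prob_Rintegral_sum; last by move=> k; exact: bounded_mfunM.
rewrite fE !big_seq; apply: eq_bigr => k /sN kN.
under eq_Rintegral do rewrite mulrDr (mulrCA (K _)) (mulrCA (K _)).
rewrite prob_RintegralD; last 2 first.
- by apply: bounded_mfunZ; apply: bounded_mfunM => //; exact: bounded_mfun_cos_dotp.
- by apply: bounded_mfunZ; apply: bounded_mfunM => //; exact: bounded_mfun_cos_dotp.
rewrite !prob_RintegralZ; try (apply: bounded_mfunM => //; exact: bounded_mfun_cos_dotp).
by rewrite !repr.
Qed.

(** Multiplying [f] by the conjugate [w] of [f x] turns the value at [x] into |f(x)|^2, so real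
    integrals suffice; dividing by |f(x)| at the end gives the bound, which is why the value 0 is
    treated apart. *)
Lemma reproducing_bound (d N : nat) (x : d.-tuple R) (L S : R) (K : d.-tuple mR -> R)
    (f : d.-tuple R -> R[i]) (B : set (d.-tuple mR)) (e M m : R) :
  reproducing_at x N L S K -> hyperbolic_poly N f ->
  measurable B -> fine (torus_prob R d B) <= e -> 0 <= M -> 0 <= m ->
  (forall u, torus R d u -> Normc.normc (f u) <= M) ->
  (forall u, (torus R d `\` B) u -> Normc.normc (f u) <= m) ->
  Normc.normc (f x) <= L * m + M * S * e.
Proof.
move=> rK fN mB Be M0 m0 fM fm.
have [fx0|fx0] := eqVneq (Normc.normc (f x)) 0.
  have [bK KS KL _] := rK; rewrite fx0 addr_ge0//.
    by rewrite mulr_ge0//; apply: le_trans KL; exact: Rintegral_ge0.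
  rewrite !mulr_ge0//; first by apply: le_trans (KS x).
  by apply: le_trans Be; exact: fine_ge0.
have {fx0}fx_gt0 : 0 < Normc.normc (f x) by rewrite lt_def fx0 normc_ge0.
pose w := (f x)^*%C.
have nw : Normc.normc w = Normc.normc (f x).
  by rewrite /w; case: (f x) => a b /=; rewrite sqrrN.
have wfx : complex.Re (w * f x) = Normc.normc (f x) ^+ 2.
  rewrite /w; case: (f x) => a b /=; rewrite sqr_sqrtr ?addr_ge0 ?sqr_ge0//; ring.
have [bg intg] := reproducing_Re w rK fN.
pose g (u : d.-tuple mR) : R := complex.Re (w * f u).
have g_le u : `|g u| <= Normc.normc (f x) * Normc.normc (f u).
  by rewrite -nw -Normc.normcM Re_le_normc.
have [G fG] := hyperbolic_poly_bounded fN.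
have [bK KS KL _] := rK.
have S0 : 0 <= S by exact: le_trans (KS x).
pose T := torus R d : set (d.-tuple mR).
(* A majorant of |f K| with one term for each region: the torus off [B], the set [B], and the null
   complement of the torus, where only the global bound [G] is available. *)
pose h u : R := m * `|K u| + (M * S) * \1_B u + (G * S) * (1 - \1_T u).
have bB : bounded_mfun (\1_B : d.-tuple mR -> R) by exact: bounded_mfun_indic.
have bT : bounded_mfun (\1_T : d.-tuple mR -> R).
  exact: (bounded_mfun_indic (@measurable_torus d)).
have b1T : bounded_mfun (fun u => 1 - (\1_T : d.-tuple mR -> R) u).
  by apply: bounded_mfunB => //; exact: bounded_mfun_cst.
have bN := bounded_mfun_norm bK.
have bh : bounded_mfun h.
  by apply: bounded_mfunD; [apply: bounded_mfunD|]; exact: bounded_mfunZ.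
have G0 : 0 <= G by apply: le_trans (normc_ge0 (f x)) (fG x).
have fK_le u : Normc.normc (f u) * `|K u| <= h u.
  rewrite /h !indicE.
  have [/set_mem uT|uT] := boolP (u \in T); last first.
    rewrite subr0 mulr1; apply: le_trans (_ : G * S <= _).
      by rewrite ler_pM// normc_ge0.
    by rewrite lerDr addr_ge0// ?mulr_ge0.
  rewrite subrr mulr0 addr0.
  have [/set_mem uB|uB] := boolP (u \in B).
    rewrite mulr1; apply: le_trans (_ : M * S <= _).
      by rewrite ler_pM// ?normc_ge0// fM.
    by rewrite lerDr mulr_ge0.
  rewrite mulr0 addr0 ler_wpM2r// fm//; split => //.
  by move=> /mem_set; rewrite (negPf uB).
have inth : \int[torus_prob R d]_u h u <= L * m + M * S * e.
  rewrite /h prob_RintegralD; last 2 first.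
  - by apply: bounded_mfunD; exact: bounded_mfunZ.
  - exact: bounded_mfunZ.
  rewrite prob_RintegralD; [|exact: bounded_mfunZ..].
  rewrite !prob_RintegralZ//.
  rewrite prob_RintegralB//; last exact: bounded_mfun_cst.
  rewrite prob_Rintegral_cst torus_prob_torus subrr mulr0 addr0.
  rewrite prob_Rintegral_indic// (mulrC L); apply: lerD; apply: ler_wpM2l => //.
  exact: mulr_ge0.
have le1 : `|\int[torus_prob R d]_u (K u * g u)| <=
    Normc.normc (f x) * \int[torus_prob R d]_u h u.
  apply: le_trans (le_norm_prob_Rintegral _ _) _; first exact: bounded_mfunM.
  rewrite -prob_RintegralZ//; apply: le_prob_Rintegral.
  - by apply: bounded_mfun_norm; exact: bounded_mfunM.
  - exact: bounded_mfunZ.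
  move=> u; rewrite normrM mulrC; apply: le_trans (ler_wpM2r (normr_ge0 _) (g_le u)) _.
  by rewrite -mulrA ler_wpM2l// normc_ge0.
move: le1; rewrite /g intg wfx ger0_norm ?sqr_ge0// expr2 ler_pM2l// => le1.
exact: le_trans le1 inth.
Qed.

End remez_bound.

(** * Choice of the dyadic level, finiteness of the suprema, and conclusion *)

Lemma up_log2_bounds (R : realType) (N : nat) : (2 <= N)%N ->
  let n := up_log 2 N in
  2 ^+ n <= 2 * N%:R :> R /\ n.+1%:R <= 3 / ln 2 * ln N%:R :> R.
Proof.
move=> N2 n; have n0 : (0 < n)%N by rewrite up_log_gt0 /= N2.
have /andP[ltN _] := up_log_bounds (isT : (1 < 2)%N) N2; rewrite -/n in ltN.
have ltNR : 2 ^+ n.-1 < N%:R :> R by rewrite -natrX ltr_nat.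
have ln2 : 0 < ln 2 :> R by rewrite ln_gt0// ltr1n.
have N0 : 0 < N%:R :> R by rewrite ltr0n; lia.
split; first by rewrite -(prednK n0) exprS ler_wpM2l// ltW.
rewrite mulrAC ler_pdivlMr//.
have le1 : ln 2 *+ n.-1 <= ln N%:R :> R.
  by rewrite -lnXn// ler_ln ?posrE ?exprn_gt0// ltW.
have le2 : ln 2 <= ln N%:R :> R by rewrite ler_ln ?posrE// ler_nat.
(* The part n-1 costs at most ln N because 2^(n-1) < N, and the remaining 2 ln 2 costs at most 2 ln
   N, whence the constant 3. *)
have -> : n.+1%:R * ln 2 = ln 2 *+ n.-1 + 2 * ln 2 :> R.
  by rewrite -{1}(prednK n0) -addn2 natrD mulrDl mulr_natl.
lra.
Qed.

(** Nonemptiness excludes the value -oo and the bound [G] excludes +oo, so the final absorption can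
    be done with real numbers. *)
Lemma fin_num_sup_norm (R : realType) (d : nat) (A : set (d.-tuple R))
    (f : d.-tuple R -> R[i]) (G : R) :
  A !=set0 -> (forall x, Normc.normc (f x) <= G) ->
  exists M : R, [/\ sup_norm A f = M%:E, 0 <= M,
    forall u, A u -> Normc.normc (f u) <= M &
    forall b : R, (forall u, A u -> Normc.normc (f u) <= b) -> M <= b].
Proof.
move=> [a Aa] fG.
have ub u : A u -> ((Normc.normc (f u))%:E <= sup_norm A f)%E.
  by move=> Au; apply: ereal_sup_ubound; exists u.
have lub (b : R) : (forall u, A u -> Normc.normc (f u) <= b) -> (sup_norm A f <= b%:E)%E.
  by move=> fb; apply: ge_ereal_sup => _ [u Au <-]; rewrite lee_fin fb.
have f0 : (0 <= sup_norm A f)%E.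
  by apply: le_trans (ub a Aa); rewrite lee_fin normc_ge0.
have fin : sup_norm A f \is a fin_num.
  by rewrite ge0_fin_numE//; apply: le_lt_trans (ltry G); apply: lub.
exists (fine (sup_norm A f)); split.
- by rewrite fineK.
- exact: fine_ge0.
- by move=> u Au; rewrite -lee_fin fineK// ub.
- by move=> b fb; rewrite -lee_fin fineK// lub.
Qed.

(** Otherwise [B] would contain the torus, which has full measure 1. *)
Lemma torus_setD_nonempty (R : realType) (d : nat)
    (B : set (d.-tuple (measurableTypeR R))) :
  measurable B -> fine (torus_prob R d B) < 1 -> torus R d `\` B !=set0.
Proof.
move=> mB; apply: contraPP => /nonemptyPn TB; apply/negP; rewrite -leNgt.
rewrite -(torus_prob_torus d) -(prob_Rintegral_indic (torus_prob R d) mB).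
apply: le_prob_Rintegral.
- exact: (bounded_mfun_indic (@measurable_torus R d)).
- exact: bounded_mfun_indic.
move=> u; rewrite !indicE ler_nat.
have [/set_mem uT|//] := boolP (u \in torus R d).
rewrite mem_set//; apply: contrapT => uB.
by have : (torus R d `\` B) u by []; rewrite TB.
Qed.

Lemma reproducing_atW (R : realType) (d N N' : nat) (x : d.-tuple R) (L S : R)
    (K : d.-tuple (measurableTypeR R) -> R) :
  (N <= N')%N -> reproducing_at x N' L S K -> reproducing_at x N L S K.
Proof.
move=> NN' [bK KS KL repr]; split=> // k kN; apply: repr.
exact: leq_trans NN'.
Qed.

Theorem theorem3p1 (R : realType) (d : nat) (hd : (1 <= d)%N) :
  exists C1 C2 : R, 0 < C1 /\ 0 < C2 /\
    forall (N : nat) (B : set (d.-tuple R)) (f : d.-tuple R -> R[i]),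
      (2 <= N)%N ->
      torus_measurable B ->
      (torus_measure B <= ((C2 * (N%:R * ln N%:R ^+ (d - 1)))^-1)%:E)%E ->
      hyperbolic_poly N f ->
      (sup_norm (torus R d) f <=
       (C1 * ln N%:R ^+ (d - 1))%:E * sup_norm (torus R d `\` B) f)%E.
Proof.
case: d hd => // d _; rewrite subn1 /=.
have [C C0 repr] := @exists_reproducing R d.
have ln2 : 0 < ln 2 :> R by rewrite ln_gt0// ltr1n.
(* Absorbs the passage from [n.+1] to [ln N]. *)
pose D : R := C * (3 / ln 2) ^+ d.
have D0 : 0 < D by rewrite mulr_gt0// exprn_gt0// divr_gt0.
pose q : R := ln 2 ^+ d; have q0 : 0 < q by rewrite exprn_gt0.
(* The term 8D makes the contribution of the exceptional set at most M/2. The term in 1/q, with q <=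
   (ln N)^d, forces [e < 1], so that the exceptional set cannot exhaust the torus. *)
pose C2 : R := 8 * D + 2 * q^-1.
have C20 : 0 < C2 by rewrite addr_gt0// mulr_gt0// invr_gt0.
exists (2 * D), C2; split; [by rewrite mulr_gt0|split=> // N B f N2 _ Bd fN].
have [pN nN] := up_log2_bounds R N2; set n := up_log 2 N in pN nN.
have N0 : 0 < N%:R :> R by rewrite ltr0n; lia.
have lnN : ln 2 <= ln N%:R :> R by rewrite ler_ln ?posrE// ler_nat.
have lnN0 : 0 < ln N%:R :> R by exact: lt_le_trans lnN.
set l : R := ln N%:R ^+ d in Bd *.
have l0 : 0 < l by rewrite exprn_gt0.
have ql : q <= l by rewrite lerXn2r// nnegrE ltW.
have nl : C * n.+1%:R ^+ d <= D * l.
  rewrite /D /l -mulrA -exprMn ler_wpM2l//; first exact: ltW.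
  have c0 : 0 <= 3 / ln 2 * ln N%:R :> R by rewrite mulr_ge0 ?divr_ge0// ltW.
  by rewrite lerXn2r ?nnegrE.
have Nl0 : 0 < C2 * (N%:R * l) by rewrite !mulr_gt0.
(* Twice the allowed measure, which gives the strict inequality needed for a Borel hull. *)
pose e : R := 2 / (C2 * (N%:R * l)).
have Be : (torus_measure B < e%:E)%E.
  apply: le_lt_trans Bd _; rewrite lte_fin /e -[ltLHS]mul1r ltr_pM2r ?invr_gt0//.
  by rewrite ltr1n.
have [B' [mB' BB' PB']] := torus_measure_hull Be.
have De : D * (2 * N%:R) * l * e <= 2^-1.
  rewrite /e [leLHS]mulrA ler_pdivrMr// /C2.
  have : 0 <= q^-1 * (N%:R * l) by rewrite !mulr_ge0// ?invr_ge0// ltW.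
  nra.
have e1 : e < 1.
  rewrite /e ltr_pdivrMr// mul1r /C2.
  have N2R : 2 <= N%:R :> R by rewrite ler_nat.
  have : 2 <= q^-1 * (N%:R * l).
    by rewrite ler_pdivlMl// [leLHS]mulrC ler_pM// ltW.
  have := mulr_gt0 D0 (mulr_gt0 N0 l0).
  lra.
have TB : torus R d.+1 `\` B !=set0.
  have [u [uT uB]] := torus_setD_nonempty mB' (le_lt_trans PB' e1).
  by exists u; split=> // /BB'.
have [G fG] := hyperbolic_poly_bounded fN.
have [m [-> m0 fm _]] := fin_num_sup_norm TB fG.
have T0 : torus R d.+1 !=set0 by case: TB => u [uT _]; exists u.
have [M [-> M0 fM Mlub]] := fin_num_sup_norm T0 fG.
rewrite -EFinM lee_fin.
(* Since [M] is finite, M/2 moves to the left; this is the factor 2 in the first constant. *)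
suff : M <= D * l * m + M * 2^-1 by lra.
(* As N <= 2^n, the kernel of level [n] reproduces the whole cross of [N]. *)
apply: Mlub => x _; have [K /(reproducing_atW (up_logP N (isT : (1 < 2)%N))) rK] := repr n x.
apply: le_trans (reproducing_bound rK fN mB' PB' M0 m0 fM _) _.
  by move=> u [uT uB']; apply: fm; split=> // /BB'.
apply: lerD; first exact: ler_wpM2r.
rewrite -mulrA; apply: ler_wpM2l => //; apply: le_trans De.
apply: ler_wpM2r; first by rewrite /e divr_ge0// ltW.
rewrite mulrAC (mulrAC D); apply: ler_pM => //; rewrite ?exprn_ge0//.
by rewrite mulr_ge0 ?exprn_ge0// ltW.
Qed.
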